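(* Let $V$ be a finite set and, for $A\subseteq V$, let $\delta_A$ and $\tau_A$ be the operations on paired matrices $(L,R)$ over $\mathbb{GF}(2)$ indexed by $V$ defined in the context. Then for every $A\subseteq V$, $$\delta_A^2=\tau_A^2=(\delta_A\tau_A)^3=\mathrm{id},$$ where products denote composition of maps on the set of paired matrices indexed by $V$ and $\mathrm{id}$ is the identity map.
   Context: All matrices are over the binary field $\mathbb{GF}(2)$. Let $V$ be a finite set with $|V|=n$. A paired matrix indexed by $V$ is a pair $(L,R)$ of $n\times n$ matrices whose rows and columns are both indexed by $V$ (in a fixed order), viewed as the $n\times 2n$ block matrix $[L\mid R]$. For $x\in V$, $L_x$ and $R_x$ denote the columns of $L$ and $R$ indexed by $x$, and $(L,R)_x=(L_x,R_x)$ is the column pair at $x$. For $x\in V$ the local operations $\delta_x$ and $\tau_x$ are defined by: $(\delta_x(L,R))_y=(R_y,L_y)$ if $y=x$ and $(\delta_x(L,R))_y=(L_y,R_y)$ if $y\neq x$; $(\tau_x(L,R))_y=(L_y+R_y,R_y)$ if $y=x$ and $(\tau_x(L,R))_y=(L_y,R_y)$ if $y\ne x$. Operations at distinct indices commute. For $A\subseteq V$, $\delta_A=\prod_{x\in A}\delta_x$ and $\tau_A=\prod_{x\in A}\tau_x$ (composition; the empty product is the identity). *)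

(* Defs.v *)
From HB Require Import structures.
From mathcomp Require Import all_boot all_order all_algebra.

Set Implicit Arguments.
Unset Strict Implicit.
Unset Printing Implicit Defensive.

Import GRing.Theory.
Local Open Scope ring_scope.

(* Rows and columns are indexed by V through the fixed order enum V:
   x : V labels the column enum_rank x. *)
Definition paired_matrix (V : finType) : Type :=
  ('M['F_2]_#|V| * 'M['F_2]_#|V|)%type.

Definition col_pair (V : finType) (P : paired_matrix V) (x : V) :
    'cV['F_2]_#|V| * 'cV['F_2]_#|V| :=
  (col (enum_rank x) P.1, col (enum_rank x) P.2).

Definition of_col_pairs (V : finType)
    (f : V -> 'cV['F_2]_#|V| * 'cV['F_2]_#|V|) : paired_matrix V :=
  (\matrix_(i, j) (f (enum_val j)).1 i 0,
   \matrix_(i, j) (f (enum_val j)).2 i 0).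

Definition delta1 (V : finType) (x : V) (P : paired_matrix V) :
    paired_matrix V :=
  of_col_pairs (fun y =>
    let: (Ly, Ry) := col_pair P y in
    if y == x then (Ry, Ly) else (Ly, Ry)).

Definition tau1 (V : finType) (x : V) (P : paired_matrix V) :
    paired_matrix V :=
  of_col_pairs (fun y =>
    let: (Ly, Ry) := col_pair P y in
    if y == x then (Ly + Ry, Ry) else (Ly, Ry)).

(* The composite is taken in the order of enum V; operations at distinct
   indices commute, so the order is immaterial. *)
Definition delta (V : finType) (A : {set V}) :
    paired_matrix V -> paired_matrix V :=
  \big[comp/id]_(x in A) @delta1 V x.

Definition tau (V : finType) (A : {set V}) :
    paired_matrix V -> paired_matrix V :=
  \big[comp/id]_(x in A) @tau1 V x.

(* Main.v *)
Require Import Defs.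
From HB Require Import structures.
From mathcomp Require Import all_boot all_order all_algebra.

(** A paired matrix is determined by its column pairs, and delta_A and tau_A act
    on each column pair indexed by A, independently, by (a, b) |-> (b, a) and
    (a, b) |-> (a + b, b).  In characteristic 2 these maps are involutions and
    their composite (a, b) |-> (b, a + b) has order 3. *)

Set Implicit Arguments.
Unset Strict Implicit.
Unset Printing Implicit Defensive.

Import GRing.Theory.
Local Open Scope ring_scope.

Lemma addmx_F2 m n (M : 'M['F_2]_(m, n)) : M + M = 0.
Proof.
by apply/matrixP=> i j; rewrite !mxE addrr_pchar2 // pchar_Fp.
Qed.

Section ColumnPairs.

Variable V : finType.
Implicit Types (P Q : paired_matrix V) (A : {set V}) (x y : V).

Lemma col_pair_inj P Q : col_pair P =1 col_pair Q -> P = Q.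
Proof.
case: P Q => [L R] [L' R'] eqPQ; congr pair; apply/matrixP=> i j;
  have [/colP/(_ i) + /colP/(_ i)] := eqPQ (enum_val j);
  by rewrite !mxE enum_valK.
Qed.

Lemma of_col_pairsK f y : col_pair (@of_col_pairs V f) y = f y.
Proof.
rewrite [f y]surjective_pairing /col_pair; congr pair; apply/colP=> i;
  by rewrite !mxE enum_rankK.
Qed.

(** Shared by [delta] and [tau]. The index list has no duplicates, so exactly one factor touches the
    pair at [y] when [y] is in [A], and none otherwise; hence [g] need not commute with anything. *)
Lemma col_pair_big_comp (g : 'cV['F_2]_#|V| * 'cV['F_2]_#|V| ->
                             'cV['F_2]_#|V| * 'cV['F_2]_#|V|)
    (f : V -> paired_matrix V -> paired_matrix V) A P y :
    (forall x Q z, col_pair (f x Q) z =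
      if z == x then g (col_pair Q z) else col_pair Q z) ->
  col_pair ((\big[comp/id]_(x in A) f x) P) y =
    if y \in A then g (col_pair P y) else col_pair P y.
Proof.
(* Naming the index list in the condition makes the claim provable by induction on any
   duplicate-free list. *)
move=> fE; have -> : (y \in A) = (y \in index_enum V) && (y \in A).
  by rewrite mem_index_enum.
elim: (index_enum V) (index_enum_uniq V) => [|x s IHs] /=.
  by rewrite big_nil.
case/andP=> xNs /IHs; rewrite big_cons inE.
have [-> | y_neq_x] := eqVneq y x => IHy.
  (* As [x] is not in [s], the tail of the composite leaves the pair at [x] unchanged. *)
  by case: ifP => xA; rewrite /= ?fE ?eqxx IHy ?(negPf xNs).
by case: ifP => _; rewrite /= ?fE ?(negPf y_neq_x) IHy.
Qed.

Lemma col_pair_delta A P y :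
  col_pair (delta A P) y =
    if y \in A then ((col_pair P y).2, (col_pair P y).1) else col_pair P y.
Proof.
by apply: (col_pair_big_comp (g := fun p => (p.2, p.1))) => x Q z;
  rewrite of_col_pairsK.
Qed.

Lemma col_pair_tau A P y :
  col_pair (tau A P) y =
    if y \in A then ((col_pair P y).1 + (col_pair P y).2, (col_pair P y).2)
    else col_pair P y.
Proof.
by apply: (col_pair_big_comp (g := fun p => (p.1 + p.2, p.2))) => x Q z;
  rewrite of_col_pairsK.
Qed.

End ColumnPairs.

Theorem theorem3p1 (V : finType) (A : {set V}) :
  [/\ iter 2 (delta A) =1 id,
      iter 2 (tau A) =1 id
    & iter 3 (delta A \o tau A) =1 id].
Proof.
split=> P; apply: col_pair_inj => y;
  rewrite /= ?(col_pair_delta, col_pair_tau); case: (y \in A) => //;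
  case: (col_pair P y) => a b //=.
- by rewrite -addrA addmx_F2 addr0.
(* The orbit is [(a, b)], [(b, a + b)], [(a + b, b + (a + b))]; this collapses the last entry to
   [a]. *)
- have baba : b + (a + b) = a by rewrite addrCA addmx_F2 addr0.
  by rewrite baba addrAC addmx_F2 add0r.
Qed.
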